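(* For all integers $m,n\geq 1$, the lattice grid graph $P_1[m+1]\times P_2[n+1]$ is antimagic.
   Context: All graphs are finite, undirected and simple. For an integer $k\geq 1$, $P[k]$ (also written $P_1[k]$, $P_2[k]$) denotes the path on $k$ vertices. The Cartesian product $G_1\times G_2$ of graphs $G_1=(V_1,E_1)$ and $G_2=(V_2,E_2)$ has vertex set $V_1\times V_2$, with $(u_1,u_2)$ adjacent to $(v_1,v_2)$ iff either $u_1=v_1$ and $u_2v_2\in E_2$, or $u_2=v_2$ and $u_1v_1\in E_1$. An antimagic labeling of a graph with $m'$ edges is a bijection $f$ from its edge set to $\{1,\ldots,m'\}$ such that the vertex sums $f^+(v)=\sum_{e\ni v} f(e)$ (sum over edges incident with $v$) are pairwise distinct over all vertices $v$. A graph is antimagic if it admits an antimagic labeling. *)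

(* Defs.v *)
From mathcomp Require Import all_boot.
Set Implicit Arguments. Unset Strict Implicit. Unset Printing Implicit Defensive.

Definition simple_graph (V : finType) (adj : rel V) : Prop :=
  symmetric adj /\ irreflexive adj.

Definition edges (V : finType) (adj : rel V) : {set {set V}} :=
  [set [set p.1; p.2] | p : V * V & adj p.1 p.2].

Definition path_adj (k : nat) : rel 'I_k :=
  fun i j => (i.+1 == j :> nat) || (j.+1 == i :> nat).

Definition cart_adj (V1 V2 : finType) (a1 : rel V1) (a2 : rel V2) : rel (V1 * V2) :=
  fun u v => ((u.1 == v.1) && a2 u.2 v.2) || ((u.2 == v.2) && a1 u.1 v.1).

Definition vsum (V : finType) (adj : rel V) (f : {set V} -> nat) (v : V) : nat :=
  \sum_(E in edges adj | v \in E) f E.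

Definition edge_labeling (V : finType) (adj : rel V) (f : {set V} -> nat) : Prop :=
  {in edges adj &, injective f} /\
  (forall E, E \in edges adj -> 1 <= f E <= #|edges adj|) /\
  (forall k, 1 <= k <= #|edges adj| -> exists2 E, E \in edges adj & f E = k).

Definition antimagic_labeling (V : finType) (adj : rel V) (f : {set V} -> nat) : Prop :=
  edge_labeling adj f /\ (forall u v : V, u != v -> vsum adj f u != vsum adj f v).

Definition antimagic (V : finType) (adj : rel V) : Prop :=
  exists f : {set V} -> nat, antimagic_labeling adj f.

Definition grid_adj (m n : nat) : rel ('I_(m.+1) * 'I_(n.+1)) :=
  cart_adj (@path_adj m.+1) (@path_adj n.+1).
Arguments grid_adj m n : clear implicits.

(* Main.v *)
(** The [m.+1 * n + m * n.+1] labels are cut into blocks of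
[s = 2n+1] consecutive integers, the last block being reduced to its first
[n] elements. A row of horizontal edges takes the first [n] labels of a block,
a row of vertical edges the last [n.+1]. Inside a block the offset of an edge
depends only on its column, so that modulo [s] the sum at a vertex outside the
top and bottom rows depends only on its column; the offsets are chosen so that
these residues are pairwise distinct. Blocks are given to rows alternately from
both ends of the grid, so that the top and bottom rows, whose vertices lack one
vertical edge, get the smallest sums (up to one coincidence of blocks when
there are three rows), while the sums inside a column increase with the rank of
the row. *)

Require Import Defs.
From mathcomp Require Import all_boot zify.
Set Implicit Arguments. Unset Strict Implicit. Unset Printing Implicit Defensive.

Ltac if_lia := repeat (case: ifP => ?); lia.

(** * Offsets inside a block and their totals by column *)

(* The offsets [n, 1, n-1, 2, ...] zigzag, so that two consecutive ones sum to
   [n] or [n+1]. *)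
Definition hoff (n j : nat) : nat := if odd j then j./2.+1 else n - j./2.

(* The last column, where only one horizontal edge ends, takes the least or the
   greatest vertical offset according to this parity; this is what keeps its
   residue away from those of the other columns. *)
Definition vshift (n : nat) : bool := ~~ odd (n.+1./2 + n.+1).

Definition voff (n j : nat) : nat :=
  n.+1 + (if j == n then (if vshift n then 0 else n)
          else vshift n + (if odd j then n.+1./2 else 0) + j./2).

(* [hsum n j + k * voff n j] is the total offset at a vertex of column [j] with
   [k] vertical edges. *)
Definition hsum (n j : nat) : nat :=
  (if 0 < j then hoff n j.-1 else 0) + (if j < n then hoff n j else 0).

Lemma hoff_range n j : j < n -> 1 <= hoff n j <= n.
Proof. rewrite /hoff; if_lia. Qed.

Lemma hoff_inj n j k : j < n -> k < n -> hoff n j = hoff n k -> j = k.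
Proof. rewrite /hoff; if_lia. Qed.

(** Closed forms by kind of column, so that the comparisons of totals below become linear
    arithmetic. *)
Variant column_spec (n j : nat) : nat -> nat -> Prop :=
| LastColumn of j = n :
    column_spec n j n.+1./2 (n.+1 + ~~ vshift n * n)
| EvenColumn k of j = k.*2 & k.*2 < n :
    column_spec n j n (n.+1 + vshift n + k)
| OddColumn k of j = k.*2.+1 & k.*2.+1 < n :
    column_spec n j n.+1 (n.+1 + vshift n + n.+1./2 + k).

Lemma columnP n j : 0 < n -> j <= n -> column_spec n j (hsum n j) (voff n j).
Proof.
move=> n_gt0; rewrite leq_eqVlt => /orP[/eqP->|ltjn].
  have -> : hsum n n = n.+1./2 by rewrite /hsum /hoff; if_lia.
  rewrite /voff eqxx.
  have -> : (if vshift n then 0 else n) = ~~ vshift n * n.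
    by case: vshift; rewrite ?mul1n.
  exact: LastColumn.
have -> : hsum n j = n + odd j by rewrite /hsum /hoff; if_lia.
rewrite /voff ltn_eqF //.
have: j = j./2.*2 + odd j by lia.
case: (odd j); rewrite ?addn1 ?addn0 ?addnA => ej.
  by apply: OddColumn => //; rewrite -ej.
by apply: EvenColumn => //; rewrite -ej.
Qed.

Lemma voff_range n j : 0 < n -> j <= n -> n < voff n j <= n.*2.+1.
Proof.
by move=> n_gt0 /(columnP n_gt0)[] => *; rewrite /vshift; lia.
Qed.

Lemma voff_inj n j k : 0 < n -> j <= n -> k <= n ->
  voff n j = voff n k -> j = k.
Proof.
move=> n_gt0 /(columnP n_gt0)[-> | j' -> ?|j' -> ?] /(columnP n_gt0)[-> | k' -> ?|k' -> ?] //;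
rewrite /vshift; case: (boolP (odd _)) => /=; lia.
Qed.

Lemma hvsum_inj n j k : 0 < n -> j <= n -> k <= n ->
  hsum n j + voff n j = hsum n k + voff n k -> j = k.
Proof.
move=> n_gt0 /(columnP n_gt0)[-> | j' -> ?|j' -> ?] /(columnP n_gt0)[-> | k' -> ?|k' -> ?] //;
rewrite /vshift; case: (boolP (odd _)) => /=; lia.
Qed.

(** With [M] and [N] arbitrary this concerns residues: in an inner row they identify the column. *)
Lemma hvvsum_inj n j k M N : 0 < n -> j <= n -> k <= n ->
  M * n.*2.+1 + (hsum n j + (voff n j).*2) =
  N * n.*2.+1 + (hsum n k + (voff n k).*2) -> j = k.
Proof.
move=> n_gt0 jn kn.
wlog leMN : j k M N jn kn / M <= N.
  by move=> H; case/orP: (leq_total M N) => h e;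
     [exact: (H j k M N)|symmetry; exact: (H k j N M)].
rewrite -(subnKC leMN); move: (N - M) => D {leMN N}.
rewrite mulnDl -addnA => /addnI; move: jn kn.
(* Two totals differ by less than two blocks, so size rules out a gap of two or more; the other two
   cases compare closed forms. *)
case: D => [|[|D]]; rewrite ?mul0n ?mul1n ?mulSnr; try move: (D * _) => e;
move=> /(columnP n_gt0)[-> | j' -> ?|j' -> ?] /(columnP n_gt0)[-> | k' -> ?|k' -> ?] //;
rewrite /vshift; case: (boolP (odd _)) => /=; lia.
Qed.

Lemma hvsum_lt n j : 0 < n -> j <= n -> hsum n j + voff n j < n.*2.+1.*2.
Proof.
by move=> n_gt0 /(columnP n_gt0)[? | j' ? ?|j' ? ?];
  rewrite /vshift; case: (boolP (odd _)) => /=; lia.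
Qed.

Lemma hvsum_spread n j k : 0 < n -> j <= n -> k <= n ->
  hsum n j + voff n j < n.*2.+1 + (hsum n k + voff n k).
Proof.
by move=> n_gt0 /(columnP n_gt0)[? | j' ? ?|j' ? ?]
                /(columnP n_gt0)[? | k' ? ?|k' ? ?];
  rewrite /vshift; case: (boolP (odd _)) => /=; lia.
Qed.

(* Needed only for three rows, where the ends of the middle row and the inner
   vertices of the bottom row have sums in the same block multiple. *)
Lemma hvvsum_end_neq_hvsum n j k : 0 < n -> (j == 0) || (j == n) -> 0 < k < n ->
  hsum n j + (voff n j).*2 <> hsum n k + voff n k.
Proof.
move=> n_gt0 hj /andP[k_gt0 ltkn].
have jn : j <= n by lia.
have kn := ltnW ltkn; move: hj k_gt0 ltkn.
move: kn; move: jn => /(columnP n_gt0)[-> | j' -> ?|j' -> ?]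
            /(columnP n_gt0)[-> | k' -> ?|k' -> ?] //;
  rewrite /vshift; case: (boolP (odd _)) => /=; lia.
Qed.

(** * Ranks of rows and gaps *)

(* Ranks the rows [0, m, 1, m-1, ...]; [fold_rank m.-1] ranks the [m] gaps
   between consecutive rows in the same way. *)
Definition fold_rank (m i : nat) : nat :=
  if i.*2 <= m then i.*2 else (m - i).*2.+1.

Definition gapsum (m i : nat) : nat :=
  (if 0 < i then fold_rank m.-1 i.-1 else 0) + (if i < m then fold_rank m.-1 i else 0).

Definition path_deg (m i : nat) : nat := (0 < i) + (i < m).

Lemma fold_le m i : i <= m -> fold_rank m i <= m.
Proof. rewrite /fold_rank; if_lia. Qed.

Lemma fold_inj m i k : i <= m -> k <= m -> fold_rank m i = fold_rank m k -> i = k.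
Proof. rewrite /fold_rank; if_lia. Qed.

(** The gaps around an inner row of rank [r] have ranks [r - 2] and [r], except at [r = m]: gap
    ranks stop at [m - 1], which replaces [r]. *)
Lemma gapsum_inner m i : 0 < i < m ->
  gapsum m i = (fold_rank m i).*2 - 2 - (fold_rank m i == m).
Proof.
move=> /andP[i_gt0 ltim]; rewrite /gapsum i_gt0 ltim /fold_rank.
if_lia.
Qed.

Lemma fold_inner m i : 0 < i < m -> 1 < fold_rank m i.
Proof. rewrite /fold_rank; if_lia. Qed.

(** * Closed form of the vertex sums, and their distinctness *)

Definition grid_sum (m n i j : nat) : nat :=
  (path_deg n j * fold_rank m i + gapsum m i) * n.*2.+1
  + (hsum n j + path_deg m i * voff n j).

Lemma inner_row_inj m i k d : 0 < i < m -> 0 < k < m -> 0 < d ->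
  d * fold_rank m i + gapsum m i = d * fold_rank m k + gapsum m k -> i = k.
Proof.
move=> hi hk d_gt0 e.
apply: (@fold_inj m); [lia|lia|].
(* Ranks at least 2 make the truncated subtractions of [gapsum_inner] exact. *)
have := fold_inner hi; have := fold_inner hk.
have := @fold_le m i; have := @fold_le m k.
move: e; rewrite !gapsum_inner //; move: (fold_rank m i) (fold_rank m k) => u v.
nia.
Qed.

Lemma path_deg_inner m i : 0 < i < m -> path_deg m i = 2.
Proof. by rewrite /path_deg => /andP[-> ->]. Qed.

Lemma path_deg_end m i : 0 < m -> (i == 0) || (i == m) -> path_deg m i = 1.
Proof. rewrite /path_deg; lia. Qed.

Lemma end_or_inner m i : i <= m -> (i == 0) || (i == m) \/ 0 < i < m.
Proof. lia. Qed.

Lemma path_deg_range m i : 0 < m -> i <= m -> 0 < path_deg m i <= 2.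
Proof. rewrite /path_deg; lia. Qed.

Lemma fold_end m : 0 < m -> fold_rank m m = 1.
Proof. rewrite /fold_rank; if_lia. Qed.

Lemma gapsum_end m : 0 < m -> gapsum m m = (1 < m).
Proof. rewrite /gapsum /fold_rank; if_lia. Qed.

Lemma gapsum0 m : gapsum m 0 = 0.
Proof. by rewrite /gapsum; case: ifP. Qed.

Lemma inner_row_neq_end_row m n i j k l : 0 < n ->
  0 < i < m -> (k == 0) || (k == m) -> j <= n -> l <= n ->
  grid_sum m n i j <> grid_sum m n k l.
Proof.
move=> n_gt0 hi hk jn ln.
have m_gt0 : 0 < m by lia.
rewrite /grid_sum (path_deg_inner hi) (path_deg_end m_gt0 hk) mul1n mul2n.
have Mk : path_deg n l * fold_rank m k + gapsum m k <= (path_deg n l).+1.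
  case/orP: hk => /eqP->; first by rewrite gapsum0 muln0.
  rewrite fold_end // gapsum_end //; lia.
have Mi : (path_deg n j).*2.+1 <= path_deg n j * fold_rank m i + gapsum m i.
  rewrite gapsum_inner //; have := fold_inner hi; have := @fold_le m i.
  move: (fold_rank m i) => u; have := path_deg_range n_gt0 jn.
  nia.
move: Mi Mk; move: (_ + gapsum m i) (_ + gapsum m k) => M N Mi Mk.
have [dj dl] := (path_deg_range n_gt0 jn, path_deg_range n_gt0 ln).
have hy := voff_range n_gt0 jn; have hl := hvsum_lt n_gt0 ln.
(* If [N < M], the two vertical offsets at the inner vertex exceed one block, while the total at the
   end row stays below two. *)
have [ltNM|leMN] := ltnP N M.
  by rewrite -(subnKC ltNM) !mulnDl mulSn; lia.
(* The bounds give [N <= 3 <= M]; equality forces an end column for [j] and an inner one for [l]. *)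
have eN : N = 3 by lia.
have eM : M = 3 by lia.
rewrite eN eM => /addnI; apply: hvvsum_end_neq_hvsum => //.
  by case: (end_or_inner jn) => // /path_deg_inner dj2; lia.
by case: (end_or_inner ln) => // /(path_deg_end n_gt0) dl1; lia.
Qed.

Lemma end_row_inj m n j l : 0 < m -> 0 < n -> j <= n -> l <= n ->
  grid_sum m n m j = grid_sum m n m l -> j = l.
Proof.
move=> m_gt0 n_gt0 jn ln.
rewrite /grid_sum (@path_deg_end m m) ?eqxx ?orbT // fold_end // gapsum_end //.
rewrite !muln1 !mul1n !mulnDl => e.
apply: (@hvsum_inj n) => //.
(* Unequal column degrees would shift the sums by a whole block, more than the totals can
   compensate. *)
have := hvsum_spread n_gt0 jn ln; have := hvsum_spread n_gt0 ln jn.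
have [dj dl] := (path_deg_range n_gt0 jn, path_deg_range n_gt0 ln).
nia.
Qed.

Lemma grid_sum_inj m n i j k l : 0 < m -> 0 < n ->
  i <= m -> k <= m -> j <= n -> l <= n ->
  grid_sum m n i j = grid_sum m n k l -> i = k /\ j = l.
Proof.
move=> m_gt0 n_gt0 im km jn ln e.
(* The block count is 0 in row [0] and positive in row [m], and totals spread over less than one
   block. *)
have first_lt_last j' l' : j' <= n -> l' <= n ->
    grid_sum m n 0 j' < grid_sum m n m l'.
  move=> jn' ln'; rewrite /grid_sum !(@path_deg_end m) ?eqxx ?orbT //.
  rewrite fold_end // gapsum_end // gapsum0 !muln0 mul0n !mul1n muln1.
  have := hvsum_spread n_gt0 jn' ln'; have := path_deg_range n_gt0 ln'.
  nia.
case: (end_or_inner im) (end_or_inner km) => hi [] hk.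
- case/orP: hi hk e => /eqP-> /orP[] /eqP-> e.
  + split=> //; apply: (@hvsum_inj n) => //; move: e.
    by rewrite /grid_sum (@path_deg_end m) // gapsum0 !muln0 !mul1n => /addnI.
  + by have := first_lt_last _ _ jn ln; rewrite e ltnn.
  + by have := first_lt_last _ _ ln jn; rewrite e ltnn.
  + by split=> //; apply: end_row_inj e.
- by case: (inner_row_neq_end_row n_gt0 hk hi ln jn).
- by case: (inner_row_neq_end_row n_gt0 hi hk jn ln).
(* For two inner rows the residue gives the column, then the block count gives the row. *)
- move: e; rewrite /grid_sum !(@path_deg_inner m) // !mul2n => e.
  have ejl := hvvsum_inj n_gt0 jn ln e.
  split=> //; move: e; rewrite ejl => /addIn /eqP; rewrite eqn_pmul2r // => /eqP.
  by apply: inner_row_inj => //; case/andP: (path_deg_range n_gt0 ln).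
Qed.

(** * Labelings of a general graph *)

Lemma edge_labeling_of_param (V K : finType) (adj : rel V) (e : K -> {set V})
    (f : {set V} -> nat) :
  edges adj = [set e k | k : K] -> injective (f \o e) ->
  (forall k, 1 <= f (e k) <= #|K|) -> edge_labeling adj f.
Proof.
move=> edgesE f_inj f_range.
have cardE : #|edges adj| = #|K|.
  by rewrite edgesE card_imset // => k l ekl; apply: f_inj; rewrite /= ekl.
have pred_lt k : (f (e k)).-1 < #|K| by have := f_range k; lia.
pose rank k : 'I_#|K| := Ordinal (pred_lt k).
have rank_inj : injective rank.
  move=> k l /(congr1 val) /= ekl; apply: f_inj => /=.
  by have := f_range k; have := f_range l; lia.
split; [|split].
- by rewrite edgesE => _ _ /imsetP[k _ ->] /imsetP[l _ ->] /f_inj ->.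
- by rewrite cardE edgesE => _ /imsetP[k _ ->].
(* Surjectivity is the pigeonhole principle, applied to labels lowered by one to fit ordinals. *)
- rewrite cardE edgesE => c c_range.
  have pc_lt : c.-1 < #|K| by lia.
  have /codomP[k /(congr1 val) /= ck] : Ordinal pc_lt \in codom rank.
    by apply: inj_card_onto => //; rewrite card_ord.
  exists (e k); first exact: imset_f.
  by have := f_range k; lia.
Qed.

Lemma set2_eq (V : finType) (u v u' v' : V) :
  [set u; v] = [set u'; v'] ->
  u = u' /\ v = v' \/ u = v' /\ v = u'.
Proof.
move=> e.
have : u \in [set u'; v'] by rewrite -e set21.
have : v \in [set u'; v'] by rewrite -e set22.
have : u' \in [set u; v] by rewrite e set21.
have : v' \in [set u; v] by rewrite e set22.
rewrite !inE => /orP[]/eqP? /orP[]/eqP? /orP[]/eqP? /orP[]/eqP?; subst; auto.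
Qed.

(** An edge is an unordered set, so some orientation is picked, harmlessly when [g] is symmetric;
    sets that are not edges get 0. *)
Definition pair_label (V : finType) (adj : rel V) (g : V -> V -> nat)
    (E : {set V}) : nat :=
  if [pick p : V * V | adj p.1 p.2 && (E == [set p.1; p.2])] is Some p
  then g p.1 p.2 else 0.

Lemma pair_labelE (V : finType) (adj : rel V) (g : V -> V -> nat) u v :
  (forall x y, g x y = g y x) -> adj u v ->
  pair_label adj g [set u; v] = g u v.
Proof.
move=> gC uv; rewrite /pair_label; case: pickP => [[x y] /= /andP[_ /eqP]|].
  by case/set2_eq=> [][-> ->].
by move/(_ (u, v)); rewrite /= uv eqxx.
Qed.

Lemma vsum_pair_label (V : finType) (adj : rel V) (g : V -> V -> nat) v :
  symmetric adj -> irreflexive adj -> (forall x y, g x y = g y x) ->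
  vsum adj (pair_label adj g) v = \sum_(w | adj v w) g v w.
Proof.
move=> adjC adjI gC; rewrite /vsum.
have starE : [set E in edges adj | v \in E] = [set [set v; w] | w in adj v].
  apply/setP=> E; rewrite inE; apply/andP/imsetP.
    case=> /imsetP[[x y]]; rewrite inE /= => xy ->; rewrite !inE => /orP[]/eqP ->.
      by exists y.
    by exists x; [rewrite -topredE /= adjC | rewrite setUC].
  case=> w vw ->; split; last exact: set21.
  by apply/imsetP; exists (v, w); rewrite ?inE.
rewrite (eq_bigl (mem [set [set v; w] | w in adj v])); last first.
  by move=> E; rewrite -starE /= inE.
rewrite big_imset /=; last first.
  (* The crossed case would make [v] its own neighbour. *)
  move=> w w' vw vw' /set2_eq[[]//|[vw'E wvE]].
  by move: vw'; rewrite -topredE /= -vw'E adjI.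
by apply: eq_bigr => w vw; rewrite pair_labelE.
Qed.

(** * Vertex sums of the labeled grid *)

Lemma path_adjC k : symmetric (@path_adj k).
Proof. by move=> i j; rewrite /path_adj orbC. Qed.

Lemma path_adj_irr k : irreflexive (@path_adj k).
Proof. by move=> i; rewrite /path_adj; lia. Qed.

Lemma grid_adjC m n : symmetric (grid_adj m n).
Proof.
move=> u v; rewrite /grid_adj /cart_adj.
by rewrite (eq_sym v.1) (eq_sym v.2) (path_adjC v.1) (path_adjC v.2).
Qed.

Lemma grid_adj_irr m n : irreflexive (grid_adj m n).
Proof. by move=> u; rewrite /grid_adj /cart_adj !path_adj_irr !andbF. Qed.

(** The minimum indexes a path edge by its lower endpoint. *)
Lemma sum_path_adj m (i : 'I_m.+1) (F : nat -> nat) :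
  \sum_(j | path_adj i j) F (minn i j) =
  (if 0 < i then F i.-1 else 0) + (if i < m then F i else 0).
Proof.
rewrite (bigID (fun j : 'I_m.+1 => j < i)) /=; congr (_ + _).
  case: ifP => i_gt0; last by rewrite big1 // => j /andP[_]; lia.
  have lt_m : i.-1 < m.+1 by have := ltn_ord i; lia.
  rewrite (big_pred1 (Ordinal lt_m)); first by congr F => /=; lia.
  by move=> j; rewrite /path_adj /= -val_eqE /=; lia.
case: ifP => ltim; last first.
  by rewrite big1 // => j; rewrite /path_adj; have := ltn_ord j; lia.
rewrite (big_pred1 (Ordinal (ltim : i.+1 < m.+1))); first by congr F => /=; lia.
by move=> j; rewrite /path_adj /= -val_eqE /=; lia.
Qed.

Lemma sum_grid_adj m n (u : 'I_m.+1 * 'I_n.+1)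
    (F : 'I_m.+1 * 'I_n.+1 -> nat) :
  \sum_(v | grid_adj m n u v) F v =
  \sum_(j | path_adj u.2 j) F (u.1, j) + \sum_(i | path_adj u.1 i) F (i, u.2).
Proof.
rewrite (bigID (fun v => u.1 == v.1)) /=; congr (_ + _).
  rewrite (reindex_onto (fun j => (u.1, j)) snd) /=; last first.
    by case=> i j /= /andP[_ /eqP->].
  apply: eq_bigl => j; rewrite /grid_adj /cart_adj /= !eqxx path_adj_irr.
  by rewrite andbF orbF !andbT.
rewrite (reindex_onto (fun i => (i, u.2)) fst) /=; last first.
  by case=> i j /andP[/orP[/andP[/= ->]//|/andP[/= /eqP-> _]]].
apply: eq_bigl => i; rewrite /grid_adj /cart_adj /= !eqxx path_adj_irr /=.
by rewrite andbF /= !andbT andb_idr //; apply: contraTneq => <-; rewrite path_adj_irr.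
Qed.

Definition grid_label (m n : nat) (u v : 'I_m.+1 * 'I_n.+1) : nat :=
  if u.1 == v.1 then fold_rank m (minn u.1 v.1) * n.*2.+1 + hoff n (minn u.2 v.2)
  else fold_rank m.-1 (minn u.1 v.1) * n.*2.+1 + voff n (minn u.2 v.2).

Lemma grid_labelC m n u v : @grid_label m n u v = grid_label v u.
Proof. by rewrite /grid_label eq_sym minnC (minnC u.2). Qed.

Lemma vsum_grid m n (u : 'I_m.+1 * 'I_n.+1) :
  vsum (grid_adj m n) (pair_label (grid_adj m n) (@grid_label m n)) u =
  grid_sum m n u.1 u.2.
Proof.
rewrite vsum_pair_label;
  [|exact: grid_adjC|exact: grid_adj_irr|exact: grid_labelC].
rewrite sum_grid_adj /grid_label /=.
under eq_bigr do rewrite eqxx minnn.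
rewrite (@sum_path_adj n u.2 (fun j => fold_rank m u.1 * n.*2.+1 + hoff n j)).
rewrite (eq_bigr (fun i : 'I_m.+1 =>
    fold_rank m.-1 (minn u.1 i) * n.*2.+1 + voff n u.2)); last first.
  move=> i ui; rewrite minnn ifN //.
  by apply: contraTneq ui => <-; rewrite path_adj_irr.
rewrite (@sum_path_adj m u.1 (fun i => fold_rank m.-1 i * n.*2.+1 + voff n u.2)).
rewrite /grid_sum /hsum /path_deg /gapsum.
by do 4 case: ifP => _; nia.
Qed.

(** * Enumeration of the grid edges and bijectivity of the labels *)

Definition grid_edge (m n : nat) (k : 'I_m.+1 * 'I_n + 'I_m * 'I_n.+1) :
    ('I_m.+1 * 'I_n.+1) * ('I_m.+1 * 'I_n.+1) :=
  match k with
  | inl (i, j) => ((i, widen_ord (leqnSn n) j), (i, lift ord0 j))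
  | inr (i, j) => ((widen_ord (leqnSn m) i, j), (lift ord0 i, j))
  end.

Lemma grid_edge_adj m n k : grid_adj m n (@grid_edge m n k).1 (grid_edge k).2.
Proof.
by case: k => [] [i j]; rewrite /grid_adj /cart_adj /path_adj /= eqxx /= ?eqxx ?orbT.
Qed.

Lemma edges_grid m n :
  edges (grid_adj m n) =
  [set [set (grid_edge k).1; (grid_edge k).2] | k : 'I_m.+1 * 'I_n + 'I_m * 'I_n.+1].
Proof.
apply/setP=> E; apply/imsetP/imsetP; last first.
  by case=> k _ ->; exists (grid_edge k); rewrite ?inE ?grid_edge_adj.
case=> [[[i j] [i' j']]]; rewrite inE /= => + ->.
(* Both orientations give the same set, so the increasing one may be assumed. *)
wlog: i j i' j' / (i <= i') && (j <= j').
  move=> H uv; have := uv; rewrite /grid_adj /cart_adj /path_adj /= => uv'.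
  have [/H|ltu] := boolP ((i <= i') && (j <= j')); first exact.
  have [||k _ ek] := H i' j' i j; [|by rewrite grid_adjC|by exists k; rewrite // setUC].
  by move: uv' ltu; rewrite -!val_eqE /=; lia.
case/andP=> lei lej; rewrite /grid_adj /cart_adj /path_adj /=.
case/orP=> /andP[/eqP<- adj_ij].
  have jn : j < n by have := ltn_ord j'; lia.
  exists (inl (i, Ordinal jn)) => //=.
  by congr [set _; _]; congr pair; apply: val_inj; rewrite /= ?/bump; lia.
have im : i < m by have := ltn_ord i'; lia.
exists (inr (Ordinal im, j)) => //=.
by congr [set _; _]; congr pair; apply: val_inj; rewrite /= ?/bump; lia.
Qed.

Definition edge_code (m n : nat) (k : 'I_m.+1 * 'I_n + 'I_m * 'I_n.+1) : nat :=
  match k with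
  | inl (i, j) => fold_rank m i * n.*2.+1 + hoff n j
  | inr (i, j) => fold_rank m.-1 i * n.*2.+1 + voff n j
  end.

Lemma pair_label_grid_edge m n (k : 'I_m.+1 * 'I_n + 'I_m * 'I_n.+1) :
  pair_label (grid_adj m n) (@grid_label m n)
    [set (grid_edge k).1; (grid_edge k).2] = edge_code k.
Proof.
rewrite pair_labelE; [|exact: grid_labelC|exact: grid_edge_adj].
case: k => [] [i j]; rewrite /grid_label /= ?eqxx ?minnn /bump /= add1n.
  by rewrite (minn_idPl (leqnSn j)).
rewrite (minn_idPl (leqnSn i)) ifN // -val_eqE /= /bump; lia.
Qed.

(** Euclidean division with remainders in [1..s], since offsets start at 1. *)
Lemma euclid_inj s a b c d : 0 < b <= s -> 0 < d <= s ->
  a * s + b = c * s + d -> a = c /\ b = d.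
Proof.
move=> hb hd e; suff eac : a = c by split=> //; move: e; rewrite eac; lia.
by case: (ltngtP a c) => // /subnKC ac; move: e; rewrite -ac !mulnDl mulSn; lia.
Qed.

Lemma edge_code_inj m n : 0 < n -> injective (@edge_code m n).
Proof.
move=> n_gt0 [] [i j] [] [k l] /=.
- have hj := hoff_range (ltn_ord j); have hl := hoff_range (ltn_ord l).
  case/euclid_inj; [lia|lia|] => ei ej; congr (inl (_, _)); apply: val_inj.
    by apply: fold_inj ei; rewrite -ltnS.
  by apply: hoff_inj ej.
(* Horizontal offsets are at most [n], vertical ones exceed it. *)
- have hj := hoff_range (ltn_ord j); have hl := voff_range n_gt0 (ltn_ord l).
  by case/euclid_inj; lia.
- have hj := voff_range n_gt0 (ltn_ord j); have hl := hoff_range (ltn_ord l).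
  by case/euclid_inj; lia.
- have hj := voff_range n_gt0 (ltn_ord j).
  have hl := voff_range n_gt0 (ltn_ord l).
  case/euclid_inj; [lia|lia|] => ei ej; congr (inr (_, _)); apply: val_inj.
    by apply: fold_inj ei; have := ltn_ord i; have := ltn_ord k; lia.
  by apply: voff_inj n_gt0 _ _ ej; rewrite -ltnS.
Qed.

Lemma edge_code_range m n (k : 'I_m.+1 * 'I_n + 'I_m * 'I_n.+1) : 0 < n ->
  1 <= edge_code k <= #|{: 'I_m.+1 * 'I_n + 'I_m * 'I_n.+1}|.
Proof.
move=> n_gt0; rewrite card_sum !card_prod !card_ord.
(* These are [m] full blocks and the [n] horizontal labels of the last one. *)
have -> : m.+1 * n + m * n.+1 = m * n.*2.+1 + n.
  by rewrite -addnn mulSn !mulnS mulnDr; lia.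
case: k => [] [i j] /=.
  have hj := hoff_range (ltn_ord j).
  rewrite addn_gt0 orbC; case/andP: hj => -> hj /=.
  by rewrite leq_add // leq_mul2r fold_le ?orbT // -ltnS.
have hj := voff_range n_gt0 (ltn_ord j).
have lt_fold : fold_rank m.-1 i < m.
  by have := @fold_le m.-1 i; have := ltn_ord i; lia.
have := leq_mul2r n.*2.+1 (fold_rank m.-1 i).+1 m; rewrite lt_fold orbT mulSn; lia.
Qed.

Theorem theorem1p1 (m n : nat) (hm : 1 <= m) (hn : 1 <= n) :
  antimagic (grid_adj m n).
Proof.
exists (pair_label (grid_adj m n) (@grid_label m n)); split; last first.
  move=> u v; rewrite !vsum_grid; apply: contraNneq => e.
  have [||||e1 e2] := grid_sum_inj hm hn _ _ _ _ e; rewrite -1?ltnS //.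
  by case: u v e1 e2 {e} => [i j] [k l] /= /val_inj-> /val_inj->.
apply: (edge_labeling_of_param (edges_grid m n)) => [k l|k] /=.
  by rewrite !pair_label_grid_edge; apply: edge_code_inj.
by rewrite pair_label_grid_edge edge_code_range.
Qed.
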